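(* Let $K\subset\mathbb{R}^2\subset\mathbb{C}^2$ be a compact subset. Then for every $(z_0,w_0)\in\mathbb{C}^2\setminus K$ there exists a polynomial $P(z,w)$ of degree two (with complex coefficients) such that $P(z_0,w_0)=1$ and $\|P\|_K<1$. Consequently $K=\mathcal{P}(K)=\mathcal{P}_2(K)$.
   Context: $\mathbb{R}^2\subset\mathbb{C}^2$ is the set of points with both coordinates real. For a compact set $K\subset\mathbb{C}^n$ and a polynomial $P$ on $\mathbb{C}^n$ with complex coefficients, $\|P\|_K=\sup_{z\in K}|P(z)|$. The polynomial hull of $K$ is $\mathcal{P}(K)=\{z\in\mathbb{C}^n:\ |P(z)|\le\|P\|_K\text{ for all polynomials }P\}$. For $d\in\mathbb{N}$, the $d$-polynomial hull of $K$ is $\mathcal{P}_d(K)=\{z\in\mathbb{C}^n:\ |P(z)|\le\|P\|_K\text{ for all polynomials }P\text{ with }\deg P\le d\}$, where $\deg$ is the total degree. *)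

(* Defs.v *)
From mathcomp Require Import all_boot all_order all_algebra.
From mathcomp Require Import complex.
From mathcomp Require Import all_classical all_reals topology normedtype.
(* The notations of mpoly clash with those of MathComp-Analysis. *)
From mathcomp Require Import -(notations) mpoly.

Set Implicit Arguments.
Unset Strict Implicit.
Unset Printing Implicit Defensive.

Import Order.TTheory GRing.Theory Num.Theory.
Import numFieldNormedType.Exports.

Local Open Scope classical_set_scope.
Local Open Scope ring_scope.

(* C^n as row vectors. The regular copy R[i]^o of R[i] is the one that carries
   the topology of the modulus, so that 'rV[R[i]^o]_n has the usual topology. *)
Notation Cspace R n := 'rV[(R[i])^o]_n.

Notation Cpoly R n := (mpoly.mpoly n R[i]).

Section PolynomialHulls.
Context {R : realType} {n : nat}.
Implicit Types (K : set (Cspace R n)) (P : Cpoly R n) (z : Cspace R n).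

Definition peval P z : R[i] := mpoly.meval (fun i => z ord0 i) P.

(* Total degree; the zero polynomial is given degree 0. *)
Definition pdeg P : nat := (mpoly.msize P).-1.

Definition pabs P z : R := ComplexField.Normc.normc (peval P z).

(* Meant for compact K, where the supremum is that of a bounded set;
   for K = set0 it is 0. *)
Definition supnorm K P : R := sup [set pabs P z | z in K].

Definition polynomial_hull K : set (Cspace R n) :=
  [set z | forall P, pabs P z <= supnorm K P].

Definition d_polynomial_hull (d : nat) K : set (Cspace R n) :=
  [set z | forall P, (pdeg P <= d)%N -> pabs P z <= supnorm K P].

Definition real_points : set (Cspace R n) :=
  [set z | forall i, complex.Im (z ord0 i) = 0].

End PolynomialHulls.

(* Main.v *)
(** The quadratic [(z - a)^2 + b^2] vanishes at [a + ib] and is positive at all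
    other real points [z].  Summed over the coordinates of [p], this gives a
    quadratic [Q] with [Q p = 0] and [Q > 0] on [K], and [1 - c Q] has the
    required properties for small [c > 0]. *)
Require Import Defs.
From mathcomp Require Import all_boot all_order all_algebra.
From mathcomp Require Import complex.
From mathcomp Require Import all_classical all_reals topology normedtype.
From mathcomp Require Import derive.
From mathcomp Require Import -(notations) mpoly.

Import Order.TTheory GRing.Theory Num.Theory.
Import numFieldNormedType.Exports.

Local Open Scope classical_set_scope.
Local Open Scope ring_scope.

Lemma normc_real (R : realType) (x : R) :
  ComplexField.Normc.normc x%:C%C = `|x|.
Proof. by rewrite /= expr0n addr0 sqrtr_sqr. Qed.

(** This is the reverse triangle inequality. The norm of [R[i]] takes its values in [R[i]], so the
    estimate is made there and carried back to [R] by [lecR]. *)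
Lemma continuous_normc (R : realType) :
  continuous (@ComplexField.Normc.normc R : (R[i])^o -> R).
Proof.
move=> z; apply/(@cvgrPdist_le _ _ _ (nbhs z)) => e e0.
have e0' : 0 < e%:C%C :> R[i] by rewrite ltcR.
near=> t.
have normE (x : R[i]) : `|x| = (ComplexField.Normc.normc x)%:C%C by [].
have : `|z - t| <= e%:C%C.
  by near: t; apply: (@cvgr_dist_le (R[i]) (R[i])^o _ _ _ id z).
have : `| `|z| - `|t| | <= `|z - t| by exact: ler_dist_dist.
by rewrite !normE -rmorphB normc_real !lecR; exact: le_trans.
Unshelve. all: by end_near. Qed.

Section Poly.
Context {R : realType} {n : nat}.
Implicit Types (K : set (Cspace R n)) (P : Cpoly R n) (z : Cspace R n).

Lemma continuous_peval P : continuous (peval P : Cspace R n -> (R[i])^o).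
Proof.
(* Powers are unfolded into iterated products, so that only continuity of addition, multiplication
   and the coordinates is used. *)
have -> : peval P = (fun z : Cspace R n => \sum_(m <- msupp P)
    mcoeff m P * \prod_i \prod_(j < m i) z ord0 i : (R[i])^o).
  apply/funext => z; rewrite /peval mevalE; apply: eq_bigr => m _.
  by congr (_ * _); apply: eq_bigr => i _; rewrite prodr_const card_ord.
move=> z; apply: (@cvg_big _ _ _ _ _ _ _ (nbhs z)) => [|m _].
  exact: add_continuous.
apply: cvgM; first exact: cvg_cst.
do 2![apply: (@cvg_big _ _ _ _ _ _ _ (nbhs z)) => [|? _];
  first exact: mul_continuous].
exact: coord_continuous.
Qed.

Lemma continuous_pabs P : continuous (pabs P : Cspace R n -> R).
Proof.
move=> z; apply: (@continuous_comp _ _ _ (peval P : _ -> (R[i])^o)).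
  exact: continuous_peval.
exact: continuous_normc.
Qed.

Lemma pabs_le_supnorm {K} P {z} : compact K -> K z -> pabs P z <= supnorm K P.
Proof.
move=> cK Kz; apply: ub_le_sup; last by exists z.
have cf : {within K, continuous (pabs P)}.
  by apply: continuous_subspaceT; exact: continuous_pabs.
have [k _ kmax] := compact_EVT_max (ex_intro _ z Kz) cK cf.
by exists (pabs P k) => _ [t Kt <-]; apply: kmax; rewrite inE.
Qed.

(** The strict bound survives the supremum because [pabs P] attains its maximum on a nonempty
    compact set. Positivity of [a] settles the case of empty [K], where the supremum is 0. *)
Lemma supnorm_lt {K P} {a : R} : compact K -> 0 < a ->
  (forall z, K z -> pabs P z < a) -> supnorm K P < a.
Proof.
move=> cK a0 ltPa; have [->|/set0P K0] := eqVneq K set0.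
  by rewrite /supnorm image_set0 sup0.
have cf : {within K, continuous (pabs P)}.
  by apply: continuous_subspaceT; exact: continuous_pabs.
have [k] := compact_EVT_max K0 cK cf; rewrite inE => Kk kmax.
apply: le_lt_trans (ltPa k Kk); apply: ge_sup; first exact: image_nonempty.
by move=> _ [t Kt <-]; apply: kmax; rewrite inE.
Qed.

Lemma sub_polynomial_hull {K} : compact K -> K `<=` polynomial_hull K.
Proof. by move=> cK z Kz P; exact: pabs_le_supnorm. Qed.

Lemma polynomial_hull_sub_d_hull d K :
  polynomial_hull K `<=` d_polynomial_hull d K.
Proof. by move=> z zK P _; exact: zK. Qed.

(* On real points this is the squared Euclidean distance to [p]; as a
   holomorphic polynomial it also vanishes at [p] itself. *)
Definition real_sqdist (p : Cspace R n) : Cpoly R n :=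
  \sum_i ((mpolyX R[i] (mnm1 i) - mpolyC n (complex.Re (p ord0 i))%:C%C) ^+ 2
          + mpolyC n ((complex.Im (p ord0 i))%:C%C ^+ 2)).

Lemma peval_real_sqdist p z : peval (real_sqdist p) z =
  \sum_i ((z ord0 i - (complex.Re (p ord0 i))%:C%C) ^+ 2
          + (complex.Im (p ord0 i))%:C%C ^+ 2).
Proof.
rewrite /peval /real_sqdist raddf_sum; apply: eq_bigr => i _ /=.
by rewrite mevalD mevalC expr2 mevalM mevalB mevalXU mevalC.
Qed.

Lemma peval_real_sqdist_self p : peval (real_sqdist p) p = 0.
Proof.
rewrite peval_real_sqdist big1 // => i _.
case: (p ord0 i) => a b /=; rewrite !expr2; simpc.
by rewrite addNr.
Qed.

(** At a real [z] every summand is a sum of two squares of real numbers. The total vanishes only if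
    each [p ord0 i] has imaginary part 0 and the same real part as [z ord0 i]; so for a non-real [p]
    it is positive at every real point. *)
Lemma peval_real_sqdist_real p {z} : real_points z ->
  exists2 r : R, peval (real_sqdist p) z = r%:C%C & 0 <= r ?= iff (z == p).
Proof.
move=> zreal.
exists (\sum_i ((complex.Re (z ord0 i) - complex.Re (p ord0 i)) ^+ 2
                + complex.Im (p ord0 i) ^+ 2)).
  rewrite peval_real_sqdist rmorph_sum; apply: eq_bigr => i _ /=.
  rewrite rmorphD !rmorphXn rmorphB /=; congr ((_ - _) ^+ 2 + _).
  by move: (zreal i); case: (z ord0 i) => a b /= ->.
have ge0 i : 0 <= (complex.Re (z ord0 i) - complex.Re (p ord0 i)) ^+ 2
                + complex.Im (p ord0 i) ^+ 2 by rewrite addr_ge0 // sqr_ge0.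
split; first exact: sumr_ge0.
rewrite eq_sym psumr_eq0 //; apply/allP/eqP => [eq0|zp i _]; last first.
  by rewrite -zp /= subrr (zreal i) expr0n /= addr0 eqxx.
apply/rowP => i; have := eq0 i (mem_index_enum i).
rewrite /= paddr_eq0 ?sqr_ge0 // !sqrf_eq0 subr_eq0 => /andP[].
by move: (zreal i); case: (z ord0 i) (p ord0 i) => a b [c d] /= -> /eqP-> /eqP->.
Qed.

(** The expanded form displays the monomials, from which both the degree bound and the leading
    coefficients of [real_sqdist] are read off. *)
Lemma sqr_mpolyX_subC (i : 'I_n) (a b : R[i]) :
  (mpolyX R[i] (mnm1 i) - mpolyC n a) ^+ 2 + mpolyC n b =
  mpolyX R[i] (mnm_muln (mnm1 i) 2) - (a *+ 2) *: mpolyX R[i] (mnm1 i)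
  + mpolyC n (a ^+ 2 + b).
Proof.
rewrite sqrrB -mulrnAr mulrC -mpolyCMn mul_mpolyC mpolyXn.
by rewrite mpolyCD expr2 mpolyCM -expr2 addrA.
Qed.

(** For a nonzero polynomial [msize] is the total degree plus one, so 3 stands for degree 2. *)
Lemma msize_real_sqdist p : (msize (real_sqdist p) <= 3)%N.
Proof.
apply: (leq_trans (msize_sum _ _ _)); apply/bigmax_leqP => i _.
rewrite sqr_mpolyX_subC.
have le3 (q1 q2 : Cpoly R n) :
    (msize q1 <= 3)%N -> (msize q2 <= 3)%N -> (msize (q1 + q2) <= 3)%N.
  by move=> s1 s2; rewrite (leq_trans (msizeD_le _ _)) // geq_max s1.
apply: (le3 _ _ (le3 _ _ _ _)).
- by rewrite msizeX mdegMn mdeg1.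
- by rewrite msizeN (leq_trans (msizeZ_le _ _)) // msizeX mdeg1.
- by rewrite msizeC; case: eqP.
Qed.

(** Only the summand of index [i] contains the square of the [i]-th variable, so nothing can cancel
    it; this keeps the degree from dropping below 2. *)
Lemma mcoeff_real_sqdist p i :
  mcoeff (mnm_muln (mnm1 i) 2) (real_sqdist p) = 1.
Proof.
rewrite /real_sqdist raddf_sum /=.
have coefE j : mcoeff (mnm_muln (mnm1 i) 2)
    ((mpolyX R[i] (mnm1 j) - mpolyC n (complex.Re (p ord0 j))%:C%C) ^+ 2
     + mpolyC n ((complex.Im (p ord0 j))%:C%C ^+ 2)) = (j == i)%:R.
  rewrite sqr_mpolyX_subC mcoeffD mcoeffB mcoeffZ mcoeffC !mcoeffX.
  have -> : (mnm1 j == mnm_muln (mnm1 i) 2) = false.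
    by apply/eqP => /(congr1 (@mdeg n)); rewrite mdegMn !mdeg1.
  rewrite -mdeg_eq0 mdegMn mdeg1 !mulr0 subr0 addr0; congr (_%:R).
  congr nat_of_bool; apply/eqP/eqP => [/mnmP/(_ j)|-> //].
  by rewrite !mulmnE !mnm1E eqxx eq_sym; case: eqVneq.
rewrite (bigD1 i) //= big1 => [|j /negbTE ji]; last by rewrite coefE ji.
by rewrite coefE eqxx addr0.
Qed.

Lemma pdeg_sub_real_sqdist p (c : R[i]) : (0 < n)%N -> c != 0 ->
  pdeg (1 - mpolyC n c * real_sqdist p) = 2%N.
Proof.
move=> n0 c0; set P := (X in pdeg X); suff: msize P = 3%N by rewrite /pdeg => ->.
apply/eqP; rewrite eqn_leq; apply/andP; split.
  rewrite (leq_trans (msizeD_le _ _)) // geq_max msize1 msizeN mul_mpolyC.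
  by rewrite (leq_trans (msizeZ_le _ _)) // msize_real_sqdist.
(* The square of the first variable has coefficient [- c], which is nonzero, so it witnesses degree
   at least 2. *)
pose m := mnm_muln (mnm1 (Ordinal n0)) 2.
have mdeg2 : mdeg m = 2%N by rewrite mdegMn mdeg1.
rewrite -mdeg2; apply: msize_mdeg_lt.
rewrite mcoeff_msupp mcoeffB mcoeff1 mcoeffCM mcoeff_real_sqdist mulr1.
by rewrite -mdeg_eq0 mdeg2 sub0r oppr_eq0.
Qed.

End Poly.

Lemma real_compact_separation (R : realType) (n : nat) (K : set (Cspace R n))
    (p : Cspace R n) : (0 < n)%N -> compact K -> K `<=` real_points -> ~ K p ->
  exists P : Cpoly R n, [/\ pdeg P = 2%N, peval P p = 1 & supnorm K P < 1].
Proof.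
move=> n0 cK Kreal Kp.
(* The maximum with 0 makes [M + 1] positive at once. Values [r] of [real_sqdist p] on [K] satisfy
   [0 < r <= M], so [c * r] lies in the interval from 0 (excluded) to 1, and [1 - c * r] has
   absolute value less than 1. *)
pose M := Num.max 0 (supnorm K (real_sqdist p)).
have M1 : 0 < M + 1 by rewrite ltr_pwDr // le_max lexx.
pose c := (M + 1)^-1.
have c0 : 0 < c by rewrite invr_gt0.
have pevalE z : peval (1 - mpolyC n c%:C%C * real_sqdist p) z =
    1 - c%:C%C * peval (real_sqdist p) z.
  by rewrite /peval mevalB meval1 mevalM mevalC.
exists (1 - mpolyC n c%:C%C * real_sqdist p); split.
- by apply: pdeg_sub_real_sqdist => //; rewrite eq_complex /= gt_eqF.
- by rewrite pevalE peval_real_sqdist_self mulr0 subr0.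
apply: supnorm_lt => // z Kz; have := pabs_le_supnorm (real_sqdist p) cK Kz.
have [r rE r0] := peval_real_sqdist_real p (Kreal z Kz).
have r_gt0 : 0 < r.
  by rewrite (lt_leif r0); apply/eqP => zp; apply: Kp; rewrite -zp.
rewrite /pabs pevalE rE -rmorphM -(rmorph1 (real_complex R)) -rmorphB !normc_real.
rewrite (gtr0_norm r_gt0) => rM.
have : c * r <= 1.
  rewrite mulrC ler_pdivrMr // mul1r (le_trans rM) // /M.
  by rewrite (le_trans (y := M)) ?le_max ?lexx ?orbT // lerDl.
rewrite -subr_ge0 => /ger0_norm ->.
by rewrite ltrBlDr ltrDl mulr_gt0.
Qed.

Theorem proposition5 (R : realType) (K : set (Cspace R 2))
    (Kcompact : compact K) (Kreal : K `<=` real_points) :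
  (forall p : Cspace R 2, ~ K p ->
     exists P : Cpoly R 2,
       [/\ pdeg P = 2%N, peval P p = 1 & supnorm K P < 1])
  /\ K = polynomial_hull K /\ polynomial_hull K = d_polynomial_hull 2 K.
Proof.
have sep p := @real_compact_separation R 2 K p isT Kcompact Kreal.
have hull2K : d_polynomial_hull 2 K `<=` K.
  (* A point of the hull outside [K] would have a separating quadratic with
     [1 = pabs P p <= supnorm K P < 1]. *)
  move=> p hp; apply: contrapT => /sep[P [degP Pp]].
  apply/negP; rewrite -leNgt (le_trans _ (hp P _)) ?degP //.
  by rewrite /pabs Pp ComplexField.Normc.normc1.
have KhullK := sub_polynomial_hull Kcompact.
have hullhull2 := @polynomial_hull_sub_d_hull R 2 2 K.
(* Both equalities follow from the cycle of inclusions of [K] in its polynomial hull, of that in the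
   2-hull, and of the 2-hull in [K]. *)
split=> //; split; apply/seteqP; split => //.
- exact: subset_trans hull2K.
- exact: subset_trans KhullK.
Qed.
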